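(* Let $(b,c)$ be a connected transient graph over $X$. Then the following assertions are equivalent. (ii.a) $Gc(x)=1$ for some (equivalently, all) $x\in X$, i.e., $1\in\mathcal{P}$. (iv.a) For some nontrivial superharmonic $u\in\mathcal{P}\cap\ell^1(X,c)$ (respectively, equivalently: for all superharmonic $u\in\mathcal{P}$; respectively, equivalently: for all superharmonic $u\in\mathcal{D}_0$), we have $$\sum_{x\in X}\mathcal{L}u(x)=\sum_{x\in X}c(x)u(x),$$ where both sides sum over positive (i.e., non-negative) terms and may be infinite. (iv.b) A positive (i.e., $\ge0$) superharmonic function $u\in\ell^1(X,c)$ is a potential if and only if $$\sum_{x\in X}\mathcal{L}u(x)=\sum_{x\in X}c(x)u(x),$$ where both sides converge absolutely. (This is asserted for every such $u$.) (iv.c) For some (equivalently, all) $x\in X$, one has $$1=\sum_{y\in X}c(y)G_x(y).$$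
   Context: Let $X$ be a countable set. A graph $(b,c)$ over $X$ consists of a symmetric function $b:X\times X\to[0,\infty)$ with $b(x,x)=0$ and $\sum_{y\in X}b(x,y)<\infty$ for all $x\in X$, and a function $c:X\to[0,\infty)$ (the killing term). The graph is connected if for all $x,y\in X$ there are $x=y_1,\dots,y_{n+1}=y$ with $b(y_i,y_{i+1})>0$ for $1\le i\le n$. Let $\mathcal{F}=\{f:X\to\mathbb{R}\mid \sum_y b(x,y)|f(y)|<\infty \text{ for all }x\}$ and, for $f\in\mathcal{F}$, $\mathcal{L}f(x)=\sum_y b(x,y)(f(x)-f(y))+c(x)f(x)$. A function $u\in\mathcal{F}$ is superharmonic if $\mathcal{L}u\ge0$ on $X$. Let $\ell^1(X,c)=\{f:X\to\mathbb{R}\mid\sum_{x}c(x)|f(x)|<\infty\}$. Let $\mathcal{Q}(f)=\frac12\sum_{x,y}b(x,y)(f(x)-f(y))^2+\sum_x c(x)f(x)^2$, $\mathcal{D}=\{f:X\to\mathbb{R}\mid\mathcal{Q}(f)<\infty\}$, and let $\mathcal{D}_0$ be the closure of the finitely supported functions in $\mathcal{D}$ with respect to $\|f\|_o=\sqrt{\mathcal{Q}(f)+|f(o)|^2}$ for a fixed $o\in X$. The connected graph $(b,c)$ is transient if for every $y\in X$ there is a unique $G_y\in\mathcal{D}_0$ with $\mathcal{L}G_y=1_{\{y\}}$. The Green function is $G(x,y)=G_y(x)$, and $Gk(x)=\sum_yG(x,y)k(y)$ for $k\ge0$ (with values in $[0,\infty]$) or for $k\in\mathcal{G}=\{k:X\to\mathbb{R}\mid\sum_yG(x,y)|k(y)|<\infty\text{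 for all }x\}$. The set of potentials is $\mathcal{P}=\{u\in\mathcal{F}\mid u=Gk\text{ for some }k\in\mathcal{G}\}$. *)

(* Defs.v *)
From mathcomp Require Import all_boot all_order all_algebra.
From mathcomp Require Import all_classical all_reals all_analysis.

Set Implicit Arguments.
Unset Strict Implicit.
Unset Printing Implicit Defensive.

Import Order.TTheory GRing.Theory Num.Theory.

Local Open Scope classical_set_scope.
Local Open Scope ring_scope.

(* [esum] is only meaningful for nonnegative terms.  [tsum h] is the sum of a
   real family: it is the absolutely convergent sum when [h] is summable, and
   the sum in [0, +oo] when [h] is nonnegative. *)
Definition tsum (R : realType) (X : countType) (h : X -> R) : \bar R :=
  (\esum_(x in [set: X]) (h^\+ x)%:E - \esum_(x in [set: X]) (h^\- x)%:E)%E.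

Record graph (R : realType) (X : countType) := Graph {
  weight : X -> X -> R;
  killing : X -> R;
  weight_ge0 : forall x y, 0 <= weight x y;
  weight_sym : forall x y, weight x y = weight y x;
  weight_diag : forall x, weight x x = 0;
  weight_sum : forall x, (\esum_(y in [set: X]) (weight x y)%:E < +oo)%E;
  killing_ge0 : forall x, 0 <= killing x }.

Section GraphTheory.
Variables (R : realType) (X : countType) (g : graph R X).
Local Notation b := (weight g).
Local Notation c := (killing g).
Implicit Types (x y o : X) (f u k : X -> R).

(* [p] lists y_2, ..., y_{n+1}; the trivial path ([n = 0]) joins x to itself. *)
Definition connected_graph : Prop :=
  forall x y, exists p : seq X,
    path (fun z w => 0 < b z w) x p /\ last x p = y.

Definition formal_domain : set (X -> R) :=
  [set f | forall x, (\esum_(y in [set: X]) (b x y * `|f y|)%:E < +oo)%E].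

(* Meaningful for [f] in [formal_domain], where the sum converges absolutely. *)
Definition laplacian f x : R :=
  fine (tsum (fun y => b x y * (f x - f y))) + c x * f x.

Definition superharmonic u : Prop :=
  formal_domain u /\ forall x, 0 <= laplacian u x.

Definition ell1 : set (X -> R) :=
  [set f | (\esum_(x in [set: X]) (c x * `|f x|)%:E < +oo)%E].

Definition energy f : \bar R :=
  ((2^-1)%:E *
     (\esum_(p in [set: X * X]) (b p.1 p.2 * (f p.1 - f p.2) ^+ 2)%:E)
   + \esum_(x in [set: X]) (c x * f x ^+ 2)%:E)%E.

Definition dirichlet : set (X -> R) := [set f | (energy f < +oo)%E].

Definition form_norm o f : \bar R := sqrte (energy f + (`|f o| ^+ 2)%:E)%E.

Definition finitely_supported : set (X -> R) :=
  [set f | finite_set [set x | f x != 0]].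

Definition dirichlet0 o : set (X -> R) :=
  [set f | dirichlet f /\ forall e : R, 0 < e ->
     exists2 phi, finitely_supported phi
                & (form_norm o (f \- phi)%R < e%:E)%E].

Definition is_green o y f : Prop :=
  [/\ dirichlet0 o f, formal_domain f
    & forall x, laplacian f x = \1_[set y] x].

Definition transient o : Prop := forall y, exists! f, is_green o y f.

(* The function G_y; the default value 0 is irrelevant on transient graphs. *)
Definition green_at o y : X -> R := xget (fun=> 0) [set f | is_green o y f].

Definition green o x y : R := green_at o y x.

Definition green_domain o : set (X -> R) :=
  [set k | forall x, summable [set: X] (fun y => (green o x y * `|k y|)%:E)].

Definition green_op o k x : \bar R := tsum (fun y => green o x y * k y).

Definition potential o : set (X -> R) :=
  [set u | formal_domain u /\
     exists2 k, green_domain o k & forall x, (u x)%:E = green_op o k x].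

End GraphTheory.

(* Main.v *)
Require Import Defs.
From mathcomp Require Import all_boot all_order all_algebra.
From mathcomp Require Import all_classical all_reals all_analysis.
From mathcomp Require Import ring lra.

(* Everything rests on a domination principle: if u is in D_0, v >= 0 is in the
   formal domain and L u <= L v, then u <= v.  It gives G >= 0, Gc <= 1,
   G(Lu) <= u for nonnegative superharmonic u, and u = G(Lu) for superharmonic
   u in D_0.  Symmetry of G and Tonelli yield, for u = Gk with k >= 0,
   sum c u = sum k Gc, to be compared with sum Lu = sum k.  Finally 1 - Gc is
   nonnegative and harmonic, so by connectedness it vanishes everywhere as soon
   as it vanishes at one point; the same argument applies to the harmonic part
   u - G(Lu) in (iv.b). *)

Set Implicit Arguments.
Unset Strict Implicit.
Unset Printing Implicit Defensive.

Import Order.TTheory GRing.Theory Num.Theory.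

Local Open Scope classical_set_scope.
Local Open Scope ring_scope.

(** No bilinear form or Hilbert space structure on D_0 is set up. For [phi] vanishing off a finite
    list [s], the finite sum of [L f x * phi x] over [s] stands in for Q(f, phi). It makes sense for
    every f in the formal domain, even of infinite energy, which lets domination compare u with a
    nonnegative v known only to lie there. Cauchy-Schwarz and the reproducing property Q(G_x, phi) =
    phi(x) are statements about these finite sums; D_0 is reached through approximants with explicit
    error bounds. Evaluation at a point is controlled in two ways: through connectedness by Q(f) +
    f(o)^2, and, for finitely supported f, by Q(f) alone with the constant Q(G_x). The second bound
    carries transience into the domination principle. The test function that closes the circle is
    G_o: its Laplacian has total mass 1, the sum of c G_o is Gc(o), and it is a nontrivial potential
    lying in D_0 and in l^1(X, c). Hence each universally quantified balance identity, read for G_o,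
    says Gc(o) = 1. *)

Local Notation nsum h := (\esum_(x in setT) (h x)%:E)%E.
Local Notation rsummable h := (summable setT (fun x => (h x)%:E)).

(** * Sums over countable sets *)

Section Sums.
Variables (R : realType) (T : countType).
Implicit Types (f g h : T -> R) (a : T -> \bar R).

Lemma esum_seq_ge (s : seq T) a : uniq s -> (forall x, 0 <= a x)%E ->
  (\sum_(x <- s) a x <= \esum_(x in setT) a x)%E.
Proof.
move=> us a0; apply: esum_ge; exists [set` s].
  by split => //; exact: finite_seq.
by rewrite fsbig_seq.
Qed.

Lemma esum_term_ge a x : (forall x, 0 <= a x)%E ->
  (a x <= \esum_(x in setT) a x)%E.
Proof. by move=> a0; have := @esum_seq_ge [:: x] a isT a0; rewrite big_seq1. Qed.

Lemma esum_seq_le a (M : \bar R) :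
  (forall s : seq T, uniq s -> \sum_(x <- s) a x <= M)%E ->
  (\esum_(x in setT) a x <= M)%E.
Proof.
move=> H; apply: ge_ereal_sup => /= _ [A [/finite_seqP[s ->] _] <-].
have -> : [set` s] = [set` undup s].
  by apply/seteqP; split => x /=; rewrite mem_undup.
by rewrite -fsbig_seq ?undup_uniq ?H ?undup_uniq.
Qed.

Lemma esumZ (r : R) a : 0 <= r -> (forall x, 0 <= a x)%E ->
  (\esum_(x in setT) (r%:E * a x) = r%:E * \esum_(x in setT) a x)%E.
Proof.
move=> r0 a0; rewrite /esum -ereal_supZl//; last first.
  by apply/set0P; exists 0%E; exists set0; [exact: fsets_set0|rewrite fsbig_set0].
congr ereal_sup; apply/seteqP; split => y /=.
  move=> [A fA <-]; exists (\sum_(x \in A) a x)%E; first by exists A.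
  by rewrite ge0_mule_fsumr.
by move=> [_ [A fA <-] <-]; exists A => //; rewrite ge0_mule_fsumr.
Qed.

Lemma esum_swap (T' : countType) (a : T -> T' -> \bar R) :
  (forall x y, 0 <= a x y)%E ->
  (\esum_(x in setT) \esum_(y in setT) a x y =
   \esum_(y in setT) \esum_(x in setT) a x y)%E.
Proof.
move=> a0; rewrite (esum_esum (J := fun=> setT))//.
rewrite (esum_esum (a := fun y x => a x y) (J := fun=> setT))//.
have -> : @setT T `*`` (fun=> @setT T') = setT `*` setT by apply/seteqP; split.
have -> : @setT T' `*`` (fun=> @setT T) = setT `*` setT by apply/seteqP; split.
rewrite (@reindex_esum _ _ _ (setT `*` setT) (setT `*` setT)
  (fun p : T' * T => (p.2, p.1)))//.
split => //.
- by move=> [? ?] [? ?] _ _ [-> ->].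
- by move=> [x y] _; exists (y, x).
Qed.

Lemma nsumD f g : (forall x, 0 <= f x) -> (forall x, 0 <= g x) ->
  (nsum (fun x => f x + g x)%R = nsum f + nsum g)%E.
Proof.
move=> f0 g0; by rewrite -esumD// => x _; rewrite lee_fin.
Qed.

Lemma nsumZ r f : 0 <= r -> (forall x, 0 <= f x) ->
  (nsum (fun x => r * f x)%R = r%:E * nsum f)%E.
Proof.
move=> r0 f0; by rewrite -esumZ// => x; rewrite lee_fin.
Qed.

Lemma rsummableE h : rsummable h = (nsum (fun x => `|h x|)%R < +oo)%E.
Proof. by []. Qed.

Lemma rsummable_ge0 h : (forall x, 0 <= h x) ->
  rsummable h = (nsum h < +oo)%E.
Proof.
move=> h0; rewrite rsummableE; congr (_ < _)%E.
by apply: eq_esum => x _; rewrite ger0_norm.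
Qed.

Lemma eq_rsummable f g : f =1 g -> rsummable g -> rsummable f.
Proof. by move=> /funext ->. Qed.

Lemma rsummable_le f g : (forall x, `|f x| <= g x) -> rsummable g -> rsummable f.
Proof.
move=> fg; rewrite !rsummableE; apply: le_lt_trans; apply: le_esum => x _.
by rewrite lee_fin (le_trans (fg x))// ler_norm.
Qed.

Lemma rsummableD f g : rsummable f -> rsummable g -> rsummable (fun x => f x + g x).
Proof. exact: summableD. Qed.

Lemma rsummableZ r f : rsummable f -> rsummable (fun x => r * f x).
Proof.
rewrite !rsummableE => sf.
under eq_esum do rewrite normrM.
by rewrite nsumZ// ; apply: lte_mul_pinfty.
Qed.

Lemma tsum_ge0 h : (forall x, 0 <= h x) -> tsum h = nsum h.
Proof.
move=> h0; rewrite /tsum [X in (_ - X)%E](_ : _ = 0%E) ?sube0.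
  by apply: eq_esum => x _; rewrite /funrpos max_l.
by apply: esum1 => x _; rewrite /funrneg max_r// oppr_le0.
Qed.

Lemma tsum_sub f g : rsummable f -> rsummable g ->
  (forall x, 0 <= f x) -> (forall x, 0 <= g x) ->
  (tsum (fun x => f x - g x)%R = nsum f - nsum g)%E.
Proof.
move=> sf sg f0 g0; rewrite -esumB//; try by move=> x _; rewrite lee_fin.
rewrite /tsum; congr (_ - _)%E; apply: eq_esum => x _.
  exact/esym/(congr1 (@^~ x) (funerpos (fun x => f x - g x))).
exact/esym/(congr1 (@^~ x) (funerneg (fun x => f x - g x))).
Qed.

(** Through [fine] an infinite sum counts as 0. Nonnegativity and transposition survive this
    default; additivity does not, hence its summability hypotheses. *)
Definition rsum h : R := fine (tsum h).

Lemma eq_rsum f g : f =1 g -> rsum f = rsum g.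
Proof. by move=> /funext ->. Qed.

Lemma rsum_ge0E h : rsummable h -> (forall x, 0 <= h x) -> (rsum h)%:E = nsum h.
Proof.
move=> sh h0; rewrite /rsum tsum_ge0// fineK// ge0_fin_numE -?rsummable_ge0//.
by apply: esum_ge0 => x _; rewrite lee_fin.
Qed.

Lemma rsum_sub f g : rsummable f -> rsummable g ->
  (forall x, 0 <= f x) -> (forall x, 0 <= g x) ->
  rsum (fun x => f x - g x) = rsum f - rsum g.
Proof.
move=> sf sg f0 g0; apply: EFin_inj.
rewrite EFinB (rsum_ge0E sf f0) (rsum_ge0E sg g0) -tsum_sub// /rsum fineK//.
by rewrite tsum_sub// -(rsum_ge0E sf f0) -(rsum_ge0E sg g0).
Qed.

Lemma rsum_ge0D f g : rsummable f -> rsummable g ->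
  (forall x, 0 <= f x) -> (forall x, 0 <= g x) ->
  rsum (fun x => f x + g x) = rsum f + rsum g.
Proof.
move=> sf sg f0 g0; apply: EFin_inj; rewrite EFinD !rsum_ge0E ?nsumD//.
- exact: rsummableD.
- by move=> x; rewrite addr_ge0.
Qed.

Lemma rsummable_pos h : rsummable h -> rsummable h^\+.
Proof.
move=> sh; apply: (@rsummable_le _ (fun x => `|h x|)) => [x|].
  by rewrite ger0_norm ?funrpos_ge0// ge_max normr_ge0 ler_norm.
by move: sh; rewrite !rsummableE; under eq_esum do rewrite -normr_id.
Qed.

Lemma rsummableN h : rsummable h -> rsummable (fun x => - h x).
Proof. by rewrite !rsummableE; under [in X in _ -> X]eq_esum do rewrite normrN. Qed.

Lemma rsummable_neg h : rsummable h -> rsummable h^\-.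
Proof. by move=> sh; rewrite -funrposN; apply/rsummable_pos/rsummableN. Qed.

Lemma rsumE h : rsummable h -> rsum h = rsum h^\+ - rsum h^\-.
Proof.
move=> sh; rewrite -rsum_sub//.
- by congr rsum; rewrite -[LHS]funrposBneg.
- exact: rsummable_pos.
- exact: rsummable_neg.
Qed.

Lemma rsumD f g : rsummable f -> rsummable g ->
  rsum (fun x => f x + g x) = rsum f + rsum g.
Proof.
move=> sf sg.
have [sf1 sf2] := (rsummable_pos sf, rsummable_neg sf).
have [sg1 sg2] := (rsummable_pos sg, rsummable_neg sg).
have -> : (fun x => f x + g x) = (fun x => (f^\+ x + g^\+ x) - (f^\- x + g^\- x)).
  by have := funrDB f g => /esym.
rewrite rsum_sub ?rsum_ge0D//; first by rewrite (rsumE sf) (rsumE sg); ring.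
- exact: rsummableD.
- exact: rsummableD.
- by move=> x; rewrite addr_ge0// funrpos_ge0.
- by move=> x; rewrite addr_ge0// funrneg_ge0.
Qed.

Lemma rsumN f : rsummable f -> rsum (fun x => - f x) = - rsum f.
Proof.
move=> sf; rewrite (rsumE (rsummableN sf)) (rsumE sf).
by rewrite (funrposN f) (funrnegN f); ring.
Qed.

Lemma rsumB f g : rsummable f -> rsummable g ->
  rsum (fun x => f x - g x) = rsum f - rsum g.
Proof. by move=> sf sg; rewrite rsumD ?rsumN//; exact: rsummableN. Qed.

Lemma rsum_ge0 f : (forall x, 0 <= f x) -> 0 <= rsum f.
Proof.
move=> f0; rewrite /rsum tsum_ge0// fine_ge0//.
by apply: esum_ge0 => x _; rewrite lee_fin.
Qed.

Lemma rsumZ r f : rsummable f -> rsum (fun x => r * f x) = r * rsum f.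
Proof.
have pos k h : 0 <= k -> rsummable h -> (forall x, 0 <= h x) ->
    rsum (fun x => k * h x) = k * rsum h.
  move=> k0 sh h0; apply: EFin_inj; rewrite EFinM !rsum_ge0E ?nsumZ//.
  - exact: rsummableZ.
  - by move=> x; rewrite mulr_ge0.
have ge0 k h : 0 <= k -> rsummable h -> rsum (fun x => k * h x) = k * rsum h.
  move=> k0 sh.
  have [s1 s2] := (rsummable_pos sh, rsummable_neg sh).
  have -> : (fun x => k * h x) = (fun x => k * h^\+ x - k * h^\- x).
    apply/funext => x; rewrite -mulrBr; congr (_ * _).
    by rewrite -[in LHS](funrposBneg h).
  rewrite rsum_sub ?(rsumE sh) ?pos//; first by ring.
  - exact: rsummableZ.
  - exact: rsummableZ.
  - by move=> x; rewrite mulr_ge0// funrpos_ge0.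
  - by move=> x; rewrite mulr_ge0// funrneg_ge0.
move=> sf; have [r0|r0] := leP 0 r; first exact: ge0.
have -> : (fun x => r * f x) = (fun x => - ((- r) * f x)).
  by apply/funext => x; ring.
rewrite rsumN; last exact: rsummableZ.
by rewrite ge0 ?oppr_ge0 1?ltW//; ring.
Qed.

Lemma le_rsum f g : rsummable f -> rsummable g -> (forall x, f x <= g x) ->
  rsum f <= rsum g.
Proof.
move=> sf sg fg; rewrite -subr_ge0 -rsumB//.
by apply: rsum_ge0 => x; rewrite subr_ge0.
Qed.

Lemma rsummable0 : rsummable (fun _ : T => 0 : R).
Proof. by rewrite rsummable_ge0// esum1 ?ltry. Qed.

Lemma nsum_delta (x : T) : nsum (fun y => (y == x)%:R : R) = 1%E.
Proof.
apply/eqP; rewrite eq_le; apply/andP; split; last first.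
  have := @esum_term_ge (fun y => ((y == x)%:R : R)%:E) x.
  by rewrite eqxx; apply => y; rewrite lee_fin.
apply: esum_seq_le => s us.
rewrite sumEFin lee_fin; have [xs|xs] := boolP (x \in s).
  rewrite (bigD1_seq x)//= eqxx big1 ?addr0// => y /negbTE ->//.
by rewrite big_seq big1 // => y ys; case: eqP => // yx; rewrite -yx ys in xs.
Qed.

Lemma rsummable_delta (x : T) h : rsummable (fun y => h y * (y == x)%:R).
Proof.
rewrite (_ : (fun y => _) = (fun y => (h x * (y == x)%:R)%:E)).
  by apply: rsummableZ; rewrite rsummable_ge0// nsum_delta ltry.
by apply/funext => y; case: eqP => [->//|_]; rewrite !mulr0.
Qed.

Lemma rsum_delta (x : T) h : rsum (fun y => h y * (y == x)%:R) = h x.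
Proof.
have s1 : rsummable (fun y => (y == x)%:R : R).
  by rewrite rsummable_ge0// nsum_delta ltry.
rewrite (@eq_rsum _ (fun y => h x * (y == x)%:R)).
  rewrite rsumZ// -[RHS]mulr1; congr (_ * _); apply: EFin_inj.
  by rewrite rsum_ge0E// nsum_delta.
by move=> y; case: eqP => [->//|_]; rewrite !mulr0.
Qed.

Lemma rsum_eq0 h : rsummable h -> (forall x, 0 <= h x) -> rsum h = 0 ->
  forall x, h x = 0.
Proof.
move=> sh h0 hz x; apply/eqP; rewrite eq_le h0 andbT -lee_fin -hz rsum_ge0E//.
by apply: (@esum_term_ge (fun x => (h x)%:E)) => y; rewrite lee_fin.
Qed.

End Sums.

(** * Sums over pairs: transposition and extraction of a row *)

Section PairSums.
Variables (R : realType) (T : countType).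
Implicit Types (h : T * T -> R) (x : T).

Lemma nsum_pair h : (forall p, 0 <= h p) ->
  nsum h = (\esum_(x in setT) nsum (fun y => h (x, y)))%E.
Proof.
move=> h0; rewrite (@esum_esum _ _ _ _ (fun=> setT)
  (fun x y => (h (x, y))%:E)) => [|x y _ _].
  2: by rewrite lee_fin.
have -> : @setT T `*`` (fun=> @setT T) = setT by apply/seteqP; split.
by apply: eq_esum => -[].
Qed.

Lemma nsum_pair_swap h : nsum h = nsum (fun p => h (p.2, p.1)).
Proof.
rewrite (@reindex_esum _ _ _ setT setT (fun p : T * T => (p.2, p.1)))//.
split => //.
- by move=> [? ?] [? ?] _ _ [-> ->].
- by move=> [x y] _; exists (y, x).
Qed.

Lemma rsummable_pair_swap h :
  rsummable h -> rsummable (fun p => h (p.2, p.1)).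
Proof. by rewrite !rsummableE (nsum_pair_swap (fun p => `|h p|)). Qed.

Lemma rsum_pair_swap h : rsum h = rsum (fun p => h (p.2, p.1)).
Proof.
rewrite /rsum /tsum; congr (fine (_ - _)); exact: nsum_pair_swap.
Qed.

(** Changing a function at one vertex affects the edge terms of the energy only in one row and one
    column of the pairs; this turns such a row back into a sum over vertices. *)
Lemma nsum_row h x : (forall p, 0 <= h p) ->
  nsum (fun p => (p.1 == x)%:R * h p) = nsum (fun y => h (x, y)).
Proof.
move=> h0; rewrite nsum_pair => [|p]; last by rewrite mulr_ge0.
transitivity (\esum_(z in setT) \esum_(y in setT) ((z == x)%:R * h (x, y))%:E)%E.
  apply: eq_esum => z _; apply: eq_esum => y _ /=.
  by case: eqP => [->//|_]; rewrite !mul0r.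
rewrite esum_swap => [|z y]; last by rewrite lee_fin mulr_ge0.
apply: eq_esum => y _; under eq_esum do rewrite mulrC.
by rewrite nsumZ// nsum_delta mule1.
Qed.

Lemma rsummable_row h x : rsummable (fun y => h (x, y)) ->
  rsummable (fun p => (p.1 == x)%:R * h p).
Proof.
rewrite !rsummableE -(@nsum_row (fun p => `|h p|))//.
by apply: le_lt_trans; apply: le_esum => p _; rewrite lee_fin normrM ger0_norm.
Qed.

Lemma rsum_row h x : rsummable (fun y => h (x, y)) ->
  rsum (fun p => (p.1 == x)%:R * h p) = rsum (fun y => h (x, y)).
Proof.
move=> sh; rewrite (rsumE sh) (rsumE (rsummable_row sh)).
have eqp : (fun p => (p.1 == x)%:R * h p)^\+ = (fun p => (p.1 == x)%:R * h^\+ p).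
  by apply/funext => p; rewrite /funrpos; case: eqP => _; rewrite ?mul1r// !mul0r maxxx.
have eqn : (fun p => (p.1 == x)%:R * h p)^\- = (fun p => (p.1 == x)%:R * h^\- p).
  apply/funext => p; rewrite /funrneg.
  by case: eqP => _; rewrite ?mul1r// !mul0r oppr0 maxxx.
rewrite eqp eqn /rsum; congr (fine _ - fine _).
  rewrite !tsum_ge0 ?nsum_row// => p; rewrite ?mulr_ge0//; exact: funrpos_ge0.
rewrite !tsum_ge0 ?nsum_row// => p; rewrite ?mulr_ge0//; exact: funrneg_ge0.
Qed.

End PairSums.

(** * The formal Laplacian and the energy *)

Section Laplacian.
Variables (R : realType) (X : countType) (g : graph R X).
Local Notation b := (weight g).
Local Notation c := (killing g).
Local Notation F := (formal_domain g).
Local Notation L := (laplacian g).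
Implicit Types (x y z : X) (f h u v : X -> R).

Definition total_degree x := rsum (b x) + c x.
Local Notation d := total_degree.

Definition neighbor_sum f x := rsum (fun y => b x y * f y).
Local Notation A := neighbor_sum.

Lemma formal_domainP f : F f <-> forall x, rsummable (fun y => b x y * f y).
Proof.
have e x : nsum (fun y => b x y * `|f y|) = nsum (fun y => `|b x y * f y|).
  by apply: eq_esum => y _; rewrite normrM (ger0_norm (weight_ge0 _ _ _)).
by split=> Ff x; have := Ff x; rewrite ?rsummableE /= ?e.
Qed.

Lemma rsummable_weight x : rsummable (b x).
Proof. rewrite rsummable_ge0; [exact: weight_sum | exact: weight_ge0]. Qed.

Lemma formal_domainZ r f : F f -> F (fun x => r * f x).
Proof.
move=> /formal_domainP Ff; apply/formal_domainP => x.
apply: eq_rsummable (rsummableZ r (Ff x)) => y; exact: mulrCA.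
Qed.

Lemma formal_domainD f h : F f -> F h -> F (fun x => f x + h x).
Proof.
move=> /formal_domainP Ff /formal_domainP Fh; apply/formal_domainP => x.
apply: eq_rsummable (rsummableD (Ff x) (Fh x)) => y; exact: mulrDr.
Qed.

Lemma formal_domainB f h : F f -> F h -> F (fun x => f x - h x).
Proof.
move=> Ff Fh; rewrite (_ : (fun x => _) = (fun x => f x + (-1) * h x)).
  by apply: formal_domainD => //; exact: formal_domainZ.
by apply/funext => x; rewrite mulN1r.
Qed.

Lemma formal_domain_cst r : F (fun=> r).
Proof.
apply/formal_domainP => x.
apply: eq_rsummable (rsummableZ r (rsummable_weight x)) => y; exact: mulrC.
Qed.

Lemma formal_domain_delta x : F (fun y => (y == x)%:R).
Proof. by apply/formal_domainP => z; exact: rsummable_delta. Qed.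

(** Separates the diagonal of [L] from an off-diagonal part that preserves positivity; the sign
    arguments below rest on this splitting. *)
Lemma laplacianE f x : F f -> L f x = d x * f x - A f x.
Proof.
move=> /formal_domainP Ff.
rewrite /laplacian /d -/(rsum _).
rewrite (@eq_rsum _ _ _ (fun y => f x * b x y - b x y * f y)); last by move=> y; ring.
have sb := rsummable_weight x.
rewrite rsumB//; last exact: rsummableZ.
by rewrite rsumZ// /neighbor_sum; ring.
Qed.

Lemma neighbor_sumD f h x : F f -> F h ->
  A (fun y => f y + h y) x = A f x + A h x.
Proof.
move=> /formal_domainP Ff /formal_domainP Fh; rewrite /A -rsumD//.
by apply: eq_rsum => y; rewrite mulrDr.
Qed.

Lemma neighbor_sumZ r f x : F f -> A (fun y => r * f y) x = r * A f x.
Proof.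
move=> /formal_domainP Ff; rewrite /A -rsumZ//.
by apply: eq_rsum => y; rewrite mulrCA.
Qed.

Lemma neighbor_sum_ge0 f x : (forall y, 0 <= f y) -> 0 <= A f x.
Proof. by move=> f0; apply: rsum_ge0 => y; rewrite mulr_ge0// weight_ge0. Qed.

Lemma laplacianD f h x : F f -> F h -> L (fun y => f y + h y) x = L f x + L h x.
Proof.
move=> Ff Fh; rewrite !laplacianE ?neighbor_sumD//; first by ring.
exact: formal_domainD.
Qed.

Lemma laplacianZ r f x : F f -> L (fun y => r * f y) x = r * L f x.
Proof.
move=> Ff; rewrite !laplacianE ?neighbor_sumZ//; first by ring.
exact: formal_domainZ.
Qed.

Lemma laplacianB f h x : F f -> F h -> L (fun y => f y - h y) x = L f x - L h x.
Proof.
move=> Ff Fh; rewrite (_ : (fun y => _) = (fun y => f y + (-1) * h y)).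
  by rewrite laplacianD ?laplacianZ//; [ring | exact: formal_domainZ].
by apply/funext => z; rewrite mulN1r.
Qed.

Lemma laplacian_cst r x : L (fun=> r) x = c x * r.
Proof.
rewrite laplacianE; last exact: formal_domain_cst.
rewrite /neighbor_sum (@eq_rsum _ _ _ (fun y => r * b x y)) => [|y].
  2: by rewrite mulrC.
by rewrite rsumZ /d; [ring | exact: rsummable_weight].
Qed.

Lemma laplacian_delta x z :
  L (fun y => (y == x)%:R) z = d z * (z == x)%:R - b z x.
Proof.
by rewrite laplacianE /neighbor_sum ?rsum_delta//; exact: formal_domain_delta.
Qed.

End Laplacian.

(** * The energy and its variation at a single vertex *)

Section Energy.
Variables (R : realType) (X : countType) (g : graph R X).
Local Notation b := (weight g).
Local Notation c := (killing g).
Local Notation F := (formal_domain g).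
Local Notation L := (laplacian g).
Local Notation D := (dirichlet g).
Local Notation d := (total_degree g).
Implicit Types (x y z : X) (f h u v : X -> R).

Let et f (p : X * X) := b p.1 p.2 * (f p.1 - f p.2) ^+ 2.
Let kt f x := c x * f x ^+ 2.

Let et_ge0 f p : 0 <= et f p.
Proof. by rewrite mulr_ge0 ?sqr_ge0 ?weight_ge0. Qed.

Let kt_ge0 f x : 0 <= kt f x.
Proof. by rewrite mulr_ge0 ?sqr_ge0 ?killing_ge0. Qed.

Definition renergy f : R :=
  2^-1 * rsum (fun p => b p.1 p.2 * (f p.1 - f p.2) ^+ 2)
  + rsum (fun x => c x * f x ^+ 2).

Lemma dirichletP f : D f <->
  rsummable (fun p => b p.1 p.2 * (f p.1 - f p.2) ^+ 2) /\
  rsummable (fun x => c x * f x ^+ 2).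
Proof.
rewrite (rsummable_ge0 (et_ge0 f)) (rsummable_ge0 (kt_ge0 f)).
rewrite /dirichlet /energy /=.
have e0 : (0 <= nsum (et f))%E by apply: esum_ge0 => p _; rewrite lee_fin.
have k0 : (0 <= nsum (kt f))%E by apply: esum_ge0 => p _; rewrite lee_fin.
rewrite -/(et f) -/(kt f).
split=> [H|[H1 H2]]; last first.
  by apply: lte_add_pinfty H2; apply: lte_mul_pinfty.
split; last first.
  apply: le_lt_trans H; rewrite leeDr// mule_ge0// lee_fin; lra.
have : ((2^-1)%:E * nsum (et f) < +oo)%E.
  by apply: le_lt_trans H; rewrite leeDl.
case: (nsum (et f)) e0 => [r||]// _.
  by move=> _; rewrite ltry.
by rewrite gt0_muley// lte_fin; lra.
Qed.

Lemma energyE f : D f -> energy g f = (renergy f)%:E.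
Proof.
move=> /dirichletP[se sk].
by rewrite /energy /renergy EFinD EFinM (rsum_ge0E se (et_ge0 f))
  (rsum_ge0E sk (kt_ge0 f)).
Qed.

Lemma renergy_ge0 f : 0 <= renergy f.
Proof.
rewrite addr_ge0//; last by apply: rsum_ge0; exact: kt_ge0.
by rewrite mulr_ge0//; apply: rsum_ge0; exact: et_ge0.
Qed.

Lemma renergy0 : renergy (fun=> 0) = 0.
Proof.
have z (T : countType) : rsum (fun _ : T => 0 : R) = 0.
  by rewrite /rsum tsum_ge0// esum1.
rewrite /renergy.
rewrite (@eq_rsum _ _ _ (fun=> 0)) ?z => [|p]; last by rewrite subrr expr0n mulr0.
rewrite (@eq_rsum _ _ _ (fun=> 0)) ?z => [|p]; last by rewrite expr0n mulr0.
by rewrite mulr0 addr0.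
Qed.

Lemma dirichlet_cst0 : D (fun=> 0).
Proof.
by apply/dirichletP; split; apply: eq_rsummable (rsummable0 _ _) => p;
  rewrite ?subrr expr0n mulr0.
Qed.

Lemma dirichletZ r f : D f -> D (fun x => r * f x).
Proof.
move=> /dirichletP[s1 s2]; apply/dirichletP; split.
  rewrite (_ : (fun p => _) = (fun p => (r ^+ 2 * et f p)%:E)).
    exact: rsummableZ.
  by apply/funext => p; rewrite /et; congr (_%:E); ring.
rewrite (_ : (fun p => _) = (fun p => (r ^+ 2 * kt f p)%:E)).
  exact: rsummableZ.
by apply/funext => p; rewrite /kt; congr (_%:E); ring.
Qed.

Lemma renergyZ r f : D f -> renergy (fun x => r * f x) = r ^+ 2 * renergy f.
Proof.
move=> /dirichletP[s1 s2].
rewrite /renergy mulrDr mulrCA -(rsumZ _ s1) -(rsumZ _ s2).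
by congr (_ * _ + _); apply: eq_rsum => p; ring.
Qed.

Let sqrD_le (r s : R) : (r + s) ^+ 2 <= 2 * r ^+ 2 + 2 * s ^+ 2.
Proof. have := sqr_ge0 (r - s); rewrite !expr2; lra. Qed.

Let et_add f h p : et (fun x => f x + h x) p <= 2 * et f p + 2 * et h p.
Proof.
rewrite /et.
have := ler_wpM2l (weight_ge0 g p.1 p.2) (sqrD_le (f p.1 - f p.2) (h p.1 - h p.2)).
by congr (_ <= _); ring.
Qed.

Let kt_add f h x : kt (fun x => f x + h x) x <= 2 * kt f x + 2 * kt h x.
Proof.
rewrite /kt; have := ler_wpM2l (killing_ge0 g x) (sqrD_le (f x) (h x)).
by congr (_ <= _); ring.
Qed.

Lemma dirichletD f h : D f -> D h -> D (fun x => f x + h x).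
Proof.
move=> /dirichletP[f1 f2] /dirichletP[h1 h2]; apply/dirichletP; split.
  apply: (rsummable_le (g := fun p => 2 * et f p + 2 * et h p)) => [p|].
    by rewrite ger0_norm; [exact: et_add | exact: (et_ge0 (fun x => f x + h x))].
  by apply: rsummableD; exact: rsummableZ.
apply: (rsummable_le (g := fun p => 2 * kt f p + 2 * kt h p)) => [p|].
  by rewrite ger0_norm; [exact: kt_add | exact: (kt_ge0 (fun x => f x + h x))].
by apply: rsummableD; exact: rsummableZ.
Qed.

(** The factor 2 comes from (r + s)^2 <= 2 r^2 + 2 s^2, applied edge by edge and vertex by vertex.
    This crude triangle inequality is enough for the approximation arguments. *)
Lemma renergyD f h : D f -> D h ->
  renergy (fun x => f x + h x) <= 2 * renergy f + 2 * renergy h.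
Proof.
move=> Df Dh; have /dirichletP[fh1 fh2] := dirichletD Df Dh.
move: Df Dh => /dirichletP[f1 f2] /dirichletP[h1 h2].
have E1 : rsum (et (fun x => f x + h x)) <= 2 * rsum (et f) + 2 * rsum (et h).
  rewrite -!rsumZ// -rsumD; [|exact: rsummableZ|exact: rsummableZ].
  apply: le_rsum fh1 _ (@et_add f h).
  by apply: rsummableD; exact: rsummableZ.
have E2 : rsum (kt (fun x => f x + h x)) <= 2 * rsum (kt f) + 2 * rsum (kt h).
  rewrite -!rsumZ// -rsumD; [|exact: rsummableZ|exact: rsummableZ].
  apply: le_rsum fh2 _ (@kt_add f h).
  by apply: rsummableD; exact: rsummableZ.
rewrite /renergy -!/(et _) -!/(kt _); lra.
Qed.

Lemma weight_renergy f x y : D f -> b x y * (f x - f y) ^+ 2 <= renergy f.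
Proof.
move=> Df; have [->|xy] := eqVneq x y.
  by rewrite weight_diag mul0r renergy_ge0.
have /dirichletP[f1 f2] := Df.
(* The sum over ordered pairs sees the edge twice, which compensates the factor 1/2 in the
   energy. *)
have : (\sum_(p <- [:: (x, y); (y, x)]) (et f p)%:E <= nsum (et f))%E.
  apply: esum_seq_ge => [|p]; last by rewrite lee_fin.
  by rewrite /= inE xpair_eqE negb_and xy.
rewrite -rsum_ge0E// sumEFin lee_fin !big_cons big_nil addr0 /et /=.
have : 0 <= rsum (kt f) by apply: rsum_ge0.
rewrite (weight_sym g y x) /renergy -!/(et _) -!/(kt _) => H1 H2.
have : (f y - f x) ^+ 2 = (f x - f y) ^+ 2 by ring.
move=> e; rewrite e in H2; lra.
Qed.

(** Green's formula at one vertex: the polar form of Q at (f, 1_x) is [L f x], and Q(1_x) is the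
    total degree. The formulas for finitely supported functions come from iterating it. *)
Lemma renergy_add_delta f x t : F f -> D f ->
  D (fun y => f y + t * (y == x)%:R) /\
  renergy (fun y => f y + t * (y == x)%:R) =
    renergy f + 2 * t * L f x + t ^+ 2 * d x.
Proof.
move=> Ff Df; have /dirichletP[f1 f2] := Df.
have sb := rsummable_weight g x.
have /formal_domainP /(_ x) sf := Ff.
pose h1 p := b p.1 p.2 * (f p.1 - f p.2).
pose h2 p := b p.1 p.2.
pose sw (h : X * X -> R) := fun p => h (p.2, p.1).
have s1 : rsummable (fun y => h1 (x, y)).
  rewrite (_ : (fun y => _) = (fun y => (f x * b x y - b x y * f y)%:E)).
    apply: rsummableD; [exact: rsummableZ|exact: rsummableN].
  by apply/funext => y; rewrite /h1; congr (_%:E); ring.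
have s2 : rsummable (fun y => h2 (x, y)) by [].
have S1 := rsummable_row s1; have S2 := rsummable_row s2.
have S1' := rsummable_pair_swap S1; have S2' := rsummable_pair_swap S2.
pose q1 p := (p.1 == x)%:R * h1 p; pose q2 p := (p.1 == x)%:R * h2 p.
(* [q1] and [q2] live on the row of x, and [sw] transposes them to its column. The pair (x, x)
   occurs in both, harmlessly since b(x, x) = 0. *)
have ete : et (fun y => f y + t * (y == x)%:R) =
  (fun p => et f p + (2 * t) * (q1 p + sw q1 p) + t ^+ 2 * (q2 p + sw q2 p)).
  apply/funext => -[y z]; rewrite /et /q1 /q2 /h1 /h2 /sw /= (weight_sym g z y).
  case: (eqVneq y x) => [->|yx]; case: (eqVneq z x) => [->|zx] /=;
    rewrite ?weight_diag; ring.
have kte : kt (fun y => f y + t * (y == x)%:R) =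
  (fun y => kt f y + (2 * t * (c y * f y) + t ^+ 2 * c y) * (y == x)%:R).
  by apply/funext => y; rewrite /kt; case: (y == x); rewrite /=; ring.
have Q1 : rsummable (fun p => q1 p + sw q1 p) by exact: rsummableD.
have Q2 : rsummable (fun p => q2 p + sw q2 p) by exact: rsummableD.
have Q1' := rsummableZ (2 * t) Q1; have Q2' := rsummableZ (t ^+ 2) Q2.
have Q3 := rsummableD f1 Q1'.
have K := rsummable_delta x (fun y => 2 * t * (c y * f y) + t ^+ 2 * c y).
have Se : rsummable (et (fun y => f y + t * (y == x)%:R)).
  by rewrite ete; exact: rsummableD.
have Sk : rsummable (kt (fun y => f y + t * (y == x)%:R)).
  by rewrite kte; exact: rsummableD.
split; first exact/dirichletP.
rewrite /renergy -/(et f) -/(kt f).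
rewrite -/(et (fun y => f y + t * (y == x)%:R)).
rewrite -/(kt (fun y => f y + t * (y == x)%:R)) ete kte.
have R1 : rsum q1 = rsum (fun y => h1 (x, y)) by exact: rsum_row.
have R2 : rsum q2 = rsum (b x) by exact: rsum_row.
have R1' : rsum (sw q1) = rsum q1 by rewrite (rsum_pair_swap q1).
have R2' : rsum (sw q2) = rsum q2 by rewrite (rsum_pair_swap q2).
rewrite (rsumD Q3 Q2') (rsumD f1 Q1') (rsumZ _ Q1) (rsumZ _ Q2).
rewrite (rsumD S1 S1') (rsumD S2 S2') (rsumD f2 K) rsum_delta.
rewrite [rsum (fun p => _ * h1 p)]R1 [rsum (fun p => _ * h2 p)]R2.
rewrite [rsum (fun p => _ * h1 _)]R1' [rsum (fun p => _ * h2 _)]R2' R1 R2.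
rewrite /laplacian -/(rsum _) /total_degree /h1 /=; lra.
Qed.

End Energy.

(** * Green's formula and Cauchy-Schwarz against finitely supported functions *)

Section FiniteSupport.
Variables (R : realType) (X : countType) (g : graph R X).
Local Notation b := (weight g).
Local Notation c := (killing g).
Local Notation F := (formal_domain g).
Local Notation L := (laplacian g).
Local Notation D := (dirichlet g).
Local Notation d := (total_degree g).
Local Notation en := (renergy g).
Implicit Types (x y z : X) (f h u v k : X -> R) (s : seq X).

(** The matrix of [L] in the basis of indicators, as in [laplacian_delta]. *)
Let a z x := d z * (z == x)%:R - b z x.

Let aC x y : a x y = a y x.
Proof.
by rewrite /a (weight_sym g x y) eq_sym; case: eqP => [->|_]//; rewrite !mulr0.
Qed.

Let axx x : a x x = d x.
Proof. by rewrite /a eqxx weight_diag mulr1 subr0. Qed.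

Let fin s k y : R := \sum_(x <- s) k x * (y == x)%:R.

Let finE s k : uniq s -> (forall x, x \notin s -> k x = 0) -> fin s k = k.
Proof.
move=> us k0; apply/funext => y; rewrite /fin; have [ys|ys] := boolP (y \in s).
  rewrite (bigD1_seq y)//= eqxx mulr1 big1 ?addr0// => x xy.
  by rewrite eq_sym (negbTE xy) mulr0.
rewrite k0// big_seq big1 // => x xs; case: eqP => [yx|]; last by rewrite mulr0.
by rewrite -yx (negbTE ys) in xs.
Qed.

Let fin_nil k : fin [::] k = fun=> 0.
Proof. by apply/funext => y; rewrite /fin big_nil. Qed.

Let fin_cons x s k : fin (x :: s) k = fun y => fin s k y + k x * (y == x)%:R.
Proof. by apply/funext => y; rewrite /fin big_cons addrC. Qed.

Let fin_laplacian s k :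
  F (fin s k) /\ forall z, L (fin s k) z = \sum_(x <- s) k x * a z x.
Proof.
elim: s => [|x s [IF IL]].
  rewrite fin_nil; split=> [|z]; first exact: formal_domain_cst.
  by rewrite big_nil laplacian_cst mulr0.
have Fd := formal_domainZ (k x) (formal_domain_delta g x).
rewrite fin_cons; split=> [|z]; first exact: formal_domainD.
rewrite laplacianD// IL laplacianZ; last exact: formal_domain_delta.
by rewrite laplacian_delta big_cons addrC.
Qed.

(** Induction on [s], adding one vertex at a time by [renergy_add_delta]. The linear term at the new
    vertex is [L] of the function built so far, and it supplies the new row and column of the
    matrix. Taking f = 0 gives the energy of the finitely supported function itself. *)
Let fin_energy f s k : F f -> D f -> D (fun y => f y + fin s k y) /\
  en (fun y => f y + fin s k y) = en f + 2 * (\sum_(x <- s) L f x * k x)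
    + \sum_(z <- s) \sum_(x <- s) k z * k x * a z x.
Proof.
move=> Ff Df; elim: s => [|x s [ID IE]].
  rewrite fin_nil !big_nil (_ : (fun y => _) = f); first by rewrite mulr0 !addr0.
  by apply/funext => y; rewrite addr0.
have [Fs Ls] := fin_laplacian s k.
have Ffs := formal_domainD Ff Fs.
rewrite fin_cons.
have -> : (fun y => f y + (fin s k y + k x * (y == x)%:R)) =
          (fun y => (f y + fin s k y) + k x * (y == x)%:R).
  by apply/funext => y; rewrite addrA.
have [D' ->] := renergy_add_delta x (k x) Ffs ID; split => //.
rewrite IE laplacianD// Ls !big_cons axx.
have -> : \sum_(z <- s) \sum_(y <- x :: s) k z * k y * a z y =
  k x * (\sum_(y <- s) k y * a x y) + \sum_(z <- s) \sum_(y <- s) k z * k y * a z y.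
  rewrite mulr_sumr -big_split/=; apply: eq_bigr => z _.
  by rewrite big_cons (aC z x); congr (_ + _); ring.
have -> : \sum_(y <- s) k x * k y * a x y = k x * (\sum_(y <- s) k y * a x y).
  by rewrite mulr_sumr; apply: eq_bigr => y _; ring.
ring.
Qed.

Section Supported.
Variables (s : seq X) (phi : X -> R).
Hypotheses (us : uniq s) (phi0 : forall x, x \notin s -> phi x = 0).

Lemma finsupp_formal_domain : F phi.
Proof. by rewrite -(finE us phi0); have [] := fin_laplacian s phi. Qed.

Lemma finsupp_laplacian z : L phi z =
  \sum_(x <- s) phi x * (d z * (z == x)%:R - b z x).
Proof. by rewrite -[in LHS](finE us phi0); have [_ ->] := fin_laplacian s phi. Qed.

Lemma finsupp_dirichlet : D phi.
Proof.
have [D' _] := fin_energy s phi (formal_domain_cst g 0) (dirichlet_cst0 g).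
by move: D'; rewrite (finE us phi0); congr D; apply/funext => y; rewrite add0r.
Qed.

Lemma finsupp_renergy : en phi = \sum_(x <- s) L phi x * phi x.
Proof.
have [_] := fin_energy s phi (formal_domain_cst g 0) (dirichlet_cst0 g).
rewrite (finE us phi0) renergy0 (_ : (fun y => _) = phi); last first.
  by apply/funext => y; rewrite add0r.
move=> ->; rewrite big1 ?mulr0 ?add0r => [|x _]; last first.
  by rewrite laplacian_cst mulr0 mul0r.
apply: eq_bigr => z _; rewrite finsupp_laplacian mulr_suml.
by apply: eq_bigr => x _; rewrite /a; ring.
Qed.

Lemma renergyD_finsupp f : F f -> D f ->
  en (fun y => f y + phi y) = en f + 2 * (\sum_(x <- s) L f x * phi x) + en phi.
Proof.
move=> Ff Df; have [_] := fin_energy s phi Ff Df.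
rewrite (finE us phi0) => ->; congr (_ + _).
rewrite finsupp_renergy; apply: eq_bigr => z _; rewrite finsupp_laplacian mulr_suml.
by apply: eq_bigr => x _; rewrite /a; ring.
Qed.

End Supported.

Lemma finsupp_laplacian_sym s phi psi : uniq s ->
  (forall x, x \notin s -> phi x = 0) -> (forall x, x \notin s -> psi x = 0) ->
  \sum_(x <- s) L phi x * psi x = \sum_(x <- s) L psi x * phi x.
Proof.
move=> us h1 h2.
under eq_bigr do rewrite (finsupp_laplacian us h1) mulr_suml.
under [RHS]eq_bigr do rewrite (finsupp_laplacian us h2) mulr_suml.
rewrite exchange_big/=; apply: eq_bigr => y _; apply: eq_bigr => x _.
by have := aC x y; rewrite /a => ->; ring.
Qed.

Lemma discriminant_le (A B C : R) : 0 <= A -> 0 <= C ->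
  (forall t, 0 <= A + 2 * t * B + t ^+ 2 * C) -> B ^+ 2 <= A * C.
Proof.
move=> A0 C0 H; have [C_gt0|C_le0] := ltP 0 C.
  have := H (- B / C).
  have -> : A + 2 * (- B / C) * B + (- B / C) ^+ 2 * C = (A * C - B ^+ 2) / C.
    by field; rewrite gt_eqF.
  by rewrite pmulr_lge0 ?invr_gt0// subr_ge0.
have {C0 C_le0}C0 : C = 0 by lra.
rewrite {}C0 in H *; rewrite mulr0; have [->|B0] := eqVneq B 0; first by rewrite expr0n.
(* For C = 0 the polynomial is affine in t, and this t gives it the value -1. *)
have := H (- (A + 1) / (2 * B)).
have -> : A + 2 * (- (A + 1) / (2 * B)) * B + (- (A + 1) / (2 * B)) ^+ 2 * 0 = -1.
  by field.
lra.
Qed.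

(** The polynomial Q(f + t psi) in t is nonnegative and its middle coefficient is the finite sum, so
    its discriminant is bounded. *)
Lemma laplacian_cauchy_schwarz f s psi : F f -> D f -> uniq s ->
  (forall x, x \notin s -> psi x = 0) ->
  (\sum_(x <- s) L f x * psi x) ^+ 2 <= en f * en psi.
Proof.
move=> Ff Df us h; apply: discriminant_le => [||t]; try exact: renergy_ge0.
have ht x : x \notin s -> t * psi x = 0 by move=> /h ->; rewrite mulr0.
have := renergyD_finsupp us ht Ff Df.
rewrite (renergyZ _ (finsupp_dirichlet us h)).
rewrite (_ : \sum_(x <- s) L f x * (t * psi x) = t * (\sum_(x <- s) L f x * psi x)).
  by rewrite mulrA => <-; exact: renergy_ge0.
by rewrite mulr_sumr; apply: eq_bigr => x _; ring.
Qed.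

(** This is Q(f^+) <= Q(f, f^+). Where f^+ is positive, f^- vanishes, so [L f^-] is there minus a
    neighbour sum of nonnegative terms. Only f^+ has finite support; f may have infinite energy, as
    phi - v may in [domination]. *)
Lemma laplacian_posE f s : F f -> uniq s ->
  (forall x, x \notin s -> f x <= 0) ->
  en (f^\+) <= \sum_(x <- s) L f x * f^\+ x.
Proof.
move=> Ff us h.
have hp x : x \notin s -> f^\+ x = 0 by move=> /h fx; rewrite /funrpos max_r.
rewrite (finsupp_renergy us hp); apply: ler_sum => x _.
have Fp := finsupp_formal_domain us hp.
have Fn : F (f^\-).
  have -> : f^\- = (fun x => f^\+ x - f x).
    apply/funext => y.
    have : f y = f^\+ y - f^\- y by rewrite -[in LHS](funrposBneg f).
    by move=> ->; ring.
  exact: formal_domainB.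
have Lf : L f x = L f^\+ x - L f^\- x.
  rewrite -(laplacianB x Fp Fn); congr (L _ x).
  by apply/funext => y; rewrite -[in LHS](funrposBneg f).
rewrite Lf mulrBl lerDl oppr_ge0.
have := neighbor_sum_ge0 g x (funrneg_ge0 f).
rewrite (laplacianE _ Fn) /funrpos /funrneg.
case: (leP (f x) 0) => fx; first by rewrite mulr0.
rewrite [X in d x * X](_ : _ = 0) => [H|]; last by rewrite max_r// lerNl oppr0 ltW.
by rewrite mulr0 sub0r mulNr oppr_le0 mulr_ge0 ?(ltW fx).
Qed.

End FiniteSupport.

(** * The space D_0 and the Green function *)

Section Dirichlet0.
Variables (R : realType) (X : countType) (g : graph R X) (o : X).
Local Notation b := (weight g).
Local Notation c := (killing g).
Local Notation F := (formal_domain g).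
Local Notation L := (laplacian g).
Local Notation D := (dirichlet g).
Local Notation D0 := (dirichlet0 g o).
Local Notation d := (total_degree g).
Local Notation en := (renergy g).
Implicit Types (x y z : X) (f h u v k : X -> R) (s : seq X).

Lemma form_normE f : D f -> form_norm g o f = (Num.sqrt (en f + f o ^+ 2))%:E.
Proof.
move=> Df; rewrite /form_norm energyE// -EFinD/=.
by rewrite -normrX ger0_norm ?sqr_ge0.
Qed.

(** The square of [form_norm] avoids square roots, and the support is recorded as a duplicate-free
    list, as the finite Green formulas require. *)
Definition approximable f : Prop := forall e : R, 0 < e ->
  exists s, exists phi : X -> R, [/\ uniq s, forall x, x \notin s -> phi x = 0
    & en (fun x => f x - phi x) + (f o - phi o) ^+ 2 < e].

Lemma dirichletB f h : D f -> D h -> D (fun x => f x - h x).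
Proof.
move=> Df Dh; rewrite (_ : (fun x => _) = (fun x => f x + (-1) * h x)).
  by apply: dirichletD => //; exact: dirichletZ.
by apply/funext => x; rewrite mulN1r.
Qed.

Lemma dirichlet0P f : D0 f <-> D f /\ approximable f.
Proof.
have nn h : 0 <= en h + h o ^+ 2 by rewrite addr_ge0 ?sqr_ge0 ?renergy_ge0.
split=> -[Df H]; split => // e e0.
  have se0 : 0 < Num.sqrt e by rewrite sqrtr_gt0.
  have [phi /finite_seqP[s sE] lt] := H _ se0.
  have hs x : x \notin undup s -> phi x = 0.
    rewrite mem_undup => xs; apply/eqP/negPn/negP => px.
    have : [set` s] x by rewrite -sE.
    by rewrite /= (negbTE xs).
  have Dp := finsupp_dirichlet g (undup_uniq s) hs.
  exists (undup s), phi; split => //; first exact: undup_uniq.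
  move: lt; rewrite form_normE; last exact: dirichletB.
  by rewrite lte_fin ltr_sqrt.
have e20 : 0 < e ^+ 2 by rewrite exprn_gt0.
have [s [phi [us hs lt]]] := H _ e20.
exists phi.
  apply: (@sub_finite_set _ _ [set` s]); last exact: finite_seq.
  by move=> x /= px; apply/negPn/negP => /hs /eqP; rewrite (negbTE px).
rewrite form_normE; last exact: dirichletB (finsupp_dirichlet g us hs).
have eE : Num.sqrt (e ^+ 2) = e by rewrite sqrtr_sqr gtr0_norm.
by rewrite lte_fin -[ltRHS]eE ltr_sqrt.
Qed.

Lemma dirichlet0_cst0 : D0 (fun=> 0).
Proof.
apply/dirichlet0P; split; first exact: dirichlet_cst0.
move=> e e0; exists [::], (fun=> 0); split=> //.
rewrite (_ : (fun x => _) = (fun=> 0)); last by apply/funext => x; rewrite subrr.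
by rewrite renergy0 subrr expr0n add0r.
Qed.

Lemma dirichlet0Z r f : D0 f -> D0 (fun x => r * f x).
Proof.
move=> /dirichlet0P[Df Af]; apply/dirichlet0P; split; first exact: dirichletZ.
move=> e e0.
(* The summand 1 covers r = 0. *)
have r1 : 0 < r ^+ 2 + 1 by rewrite ltr_wpDl ?sqr_ge0.
have [s [phi [us hs lt]]] := Af _ (divr_gt0 e0 r1).
exists s, (fun x => r * phi x); split => // [x /hs ->|]; first by rewrite mulr0.
have -> : (fun x => r * f x - r * phi x) = (fun x => r * (f x - phi x)).
  by apply/funext => x; rewrite mulrBr.
rewrite renergyZ; last exact: dirichletB (finsupp_dirichlet g us hs).
rewrite -mulrBr exprMn -mulrDr.
move: lt; rewrite ltr_pdivlMr//; apply: le_lt_trans.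
rewrite [leRHS]mulrC ler_wpM2r ?lerDl//.
by rewrite addr_ge0 ?sqr_ge0 ?renergy_ge0.
Qed.

Lemma dirichlet0D f h : D0 f -> D0 h -> D0 (fun x => f x + h x).
Proof.
move=> /dirichlet0P[Df Af] /dirichlet0P[Dh Ah]; apply/dirichlet0P.
split; first exact: dirichletD.
(* [renergyD] doubles each error, so two errors below e / 4 add up to less than e. *)
move=> e e0; have e4 : 0 < e / 4 by rewrite divr_gt0.
have [s [phi [us hs lts]]] := Af _ e4.
have [t [psi [ut ht ltt]]] := Ah _ e4.
exists (undup (s ++ t)), (fun x => phi x + psi x); split.
- exact: undup_uniq.
- move=> x; rewrite mem_undup mem_cat negb_or => /andP[/hs -> /ht ->].
  by rewrite addr0.
- have -> : (fun x => f x + h x - (phi x + psi x)) =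
            (fun x => (f x - phi x) + (h x - psi x)).
    by apply/funext => x; ring.
  have D1 := dirichletB Df (finsupp_dirichlet g us hs).
  have D2 := dirichletB Dh (finsupp_dirichlet g ut ht).
  have := renergyD D1 D2.
  have := sqr_ge0 ((f o - phi o) - (h o - psi o)).
  rewrite !expr2 in lts ltt *; lra.
Qed.

Lemma dirichlet0_sum s (k : X -> R) (H : X -> X -> R) :
  (forall y, D0 (H y)) -> D0 (fun x => \sum_(y <- s) k y * H y x).
Proof.
move=> DH; elim: s => [|y s IH].
  by rewrite (_ : (fun x => _) = (fun=> 0));
    [exact: dirichlet0_cst0 | apply/funext => x; rewrite big_nil].
rewrite (_ : (fun x => _) = (fun x => k y * H y x + \sum_(z <- s) k z * H z x)).
  by apply: dirichlet0D => //; exact: dirichlet0Z.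
by apply/funext => x; rewrite big_cons.
Qed.

Hypothesis g_connected : connected_graph g.

(** Point evaluation is continuous for the form norm: the bound is carried along a path from o, each
    edge being controlled by its own energy term. *)
Lemma eval_bound x : exists C : R, 0 <= C /\
  forall f, D f -> f x ^+ 2 <= C * (en f + f o ^+ 2).
Proof.
pose B z := exists C : R, 0 <= C /\
  forall f, D f -> f z ^+ 2 <= C * (en f + f o ^+ 2).
have [p [pp <-]] := g_connected o x; rewrite -/(B _).
have : B o by exists 1; split => // f _; have := renergy_ge0 g f; lra.
elim: p (o) pp => [//|y p IH z] /= /andP[bzy pp] [C [C0 HC]].
(* The constant comes from f(y)^2 <= 2 f(z)^2 + 2 (f(z) - f(y))^2, the last square being at most
   Q(f) / b(z, y). *)
apply: IH pp _; exists (2 * C + 2 / b z y).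
split=> [|f Df].
  by rewrite addr_ge0// mulr_ge0// invr_ge0 ltW.
have H1 := HC f Df; have H2 := weight_renergy z y Df.
have E0 := renergy_ge0 g f.
have H3 : (f z - f y) ^+ 2 <= (b z y)^-1 * (en f + f o ^+ 2).
  rewrite ler_pdivlMl//; have := sqr_ge0 (f o); lra.
have H4 : f y ^+ 2 <= 2 * f z ^+ 2 + 2 * (f z - f y) ^+ 2.
  by have := sqr_ge0 (2 * f z - f y); rewrite !expr2; lra.
rewrite mulrDl -!mulrA; lra.
Qed.

End Dirichlet0.

(** * Domination principle, positivity and symmetry of the Green function *)

Section Green.
Variables (R : realType) (X : countType) (g : graph R X) (o : X).
Local Notation b := (weight g).
Local Notation c := (killing g).
Local Notation F := (formal_domain g).
Local Notation L := (laplacian g).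
Local Notation D := (dirichlet g).
Local Notation D0 := (dirichlet0 g o).
Local Notation d := (total_degree g).
Local Notation en := (renergy g).
Implicit Types (x y z : X) (f h u v k : X -> R) (s : seq X).

Hypothesis g_connected : connected_graph g.
Hypothesis g_transient : transient g o.

Local Notation G := (green_at g o).

Lemma green_spec y : is_green g o y (G y).
Proof. by apply: xgetPex; have [f [? _]] := g_transient y; exists f. Qed.

Lemma green_dirichlet0 y : D0 (G y). Proof. by have [] := green_spec y. Qed.

Lemma green_formal_domain y : F (G y). Proof. by have [] := green_spec y. Qed.

Lemma green_laplacian y x : L (G y) x = (x == y)%:R.
Proof.
have [_ _ ->] := green_spec y; by rewrite indicE in_set1.
Qed.

Lemma green_reproducing x s phi : uniq s -> (forall y, y \notin s -> phi y = 0) ->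
  \sum_(y <- s) L (G x) y * phi y = phi x.
Proof.
move=> us hs; under eq_bigr do rewrite green_laplacian.
have [xs|xs] := boolP (x \in s).
  by rewrite (bigD1_seq x)//= eqxx mul1r big1 ?addr0// => y /negbTE ->; rewrite mul0r.
rewrite hs// big_seq big1// => y ys; case: eqP => [yx|_]; last by rewrite mul0r.
by rewrite yx (negbTE xs) in ys.
Qed.

(** Cauchy-Schwarz applied to phi(x) = Q(G_x, phi). In contrast to [eval_bound], no term at o
    occurs, so small energy alone forces small values. *)
Lemma finsupp_eval_le x s phi : uniq s -> (forall y, y \notin s -> phi y = 0) ->
  phi x ^+ 2 <= en (G x) * en phi.
Proof.
move=> us hs; rewrite -{1}(green_reproducing x us hs).
apply: laplacian_cauchy_schwarz => //; first exact: green_formal_domain.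
by have /dirichlet0P[] := green_dirichlet0 x.
Qed.

Lemma eq0_small (r C : R) : 0 <= C ->
  (forall e, 0 < e -> r <= C * e) -> r <= 0.
Proof.
move=> C0 H; rewrite leNgt; apply/negP => r0.
have C1 : 0 < C + 1 by rewrite ltr_wpDl.
have q0 := divr_gt0 r0 C1; have := H _ q0.
have : r / (C + 1) * (C + 1) = r by rewrite divfK// gt_eqF.
set q := r / _ in q0 *; rewrite mulrDr; lra.
Qed.

(* With phi finitely supported and close to u, the truncation psi = (phi - v)^+
   is finitely supported and satisfies
   Q(psi) <= Q(phi - v, psi) <= Q(phi - u, psi), since L (u - v) <= 0.
   Cauchy-Schwarz makes Q(psi) small, and G reproduces the values of psi. *)
Lemma domination u v : D0 u -> F u -> F v -> (forall x, 0 <= v x) ->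
  (forall x, L u x <= L v x) -> forall x, u x <= v x.
Proof.
move=> /dirichlet0P[Du Au] Fu Fv v0 Luv x.
have [C [C0 HC]] := eval_bound o g_connected x.
have G0 := renergy_ge0 g (G x).
rewrite -subr_le0; have [//|uv_gt0] := leP (u x - v x) 0.
suff : (u x - v x) ^+ 2 <= 0.
  by rewrite leNgt exprn_gt0.
(* Where u - v is positive it is at most (u - phi) + psi. The term 2 C bounds the first summand by
   [eval_bound], the other one bounds psi by its energy. *)
apply: (@eq0_small _ (2 * C + 2 * en (G x))) => [|e e0]; first by lra.
have [s [phi [us hs lt]]] := Au _ e0.
have Fphi := finsupp_formal_domain g us hs.
have Dphi := finsupp_dirichlet g us hs.
have Ff := formal_domainB Fphi Fv.
pose psi := (fun y => phi y - v y)^\+.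
have hf y : y \notin s -> phi y - v y <= 0 by move=> /hs ->; rewrite sub0r oppr_le0.
have hpsi y : y \notin s -> psi y = 0 by move=> /hf H; rewrite /psi /funrpos max_r.
have Fup := formal_domainB Fu Fphi; have Dup := dirichletB Du Dphi.
have E1 : en psi <= - \sum_(y <- s) L (fun y => u y - phi y) y * psi y.
  apply: le_trans (laplacian_posE Ff us hf) _; rewrite -/psi -sumrN.
  apply: ler_sum => y _; rewrite -mulNr ler_wpM2r ?funrpos_ge0//.
  rewrite !laplacianB//; have := Luv y; lra.
have E2 := laplacian_cauchy_schwarz Fup Dup us hpsi.
have P0 := renergy_ge0 g psi.
have E3 : en psi <= en (fun y => u y - phi y).
  have [->|ne] := eqVneq (en psi) 0; first exact: renergy_ge0.
  have pos : 0 < en psi by rewrite lt_neqAle eq_sym ne.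
  rewrite -(ler_pM2r pos); apply: le_trans E2; rewrite -sqrrN expr2.
  by rewrite ler_pM// ltW.
have E4 := finsupp_eval_le x us hpsi.
have E5 := HC _ Dup.
have U0 := renergy_ge0 g (fun y => u y - phi y).
have o0 := sqr_ge0 (u o - phi o).
have E6 : (u x - v x) ^+ 2 <= 2 * (u x - phi x) ^+ 2 + 2 * psi x ^+ 2.
  have p1 : phi x - v x <= psi x by rewrite /psi /funrpos le_max lexx.
  have : (u x - v x) ^+ 2 <= (u x - phi x + psi x) ^+ 2.
    rewrite ler_sqr ?nnegrE; lra.
  have := sqr_ge0 ((u x - phi x) - psi x); rewrite !expr2; lra.
have E7 : C * (en (fun y => u y - phi y) + (u o - phi o) ^+ 2) <= C * e.
  by rewrite ler_wpM2l// ltW.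
have E8 : en (G x) * en psi <= en (G x) * e.
  by rewrite ler_wpM2l//; lra.
lra.
Qed.

Lemma green_ge0 y x : 0 <= G y x.
Proof.
rewrite -oppr_le0.
have FG := green_formal_domain y.
have := @domination (fun x => (-1) * G y x) (fun=> 0).
rewrite -[- G y x]mulN1r; apply => //.
- exact/dirichlet0Z/green_dirichlet0.
- exact: formal_domainZ.
- exact: formal_domain_cst.
- by move=> z; rewrite laplacianZ// laplacian_cst mulr0 green_laplacian mulN1r oppr_le0.
Qed.

Lemma superharmonic_dirichlet0_ge0 u : D0 u -> superharmonic g u -> forall x, 0 <= u x.
Proof.
move=> Du [Fu Lu] x; rewrite -oppr_le0 -mulN1r.
apply: (@domination (fun x => (-1) * u x) (fun=> 0)) => //.
- exact/dirichlet0Z.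
- exact: formal_domainZ.
- exact: formal_domain_cst.
- by move=> z; rewrite laplacianZ// laplacian_cst mulr0 mulN1r oppr_le0.
Qed.

Lemma green_approx z x : exists C : R, 0 <= C /\
  forall e : R, 0 < e -> e <= 1 -> exists s phi,
   [/\ uniq s, forall y, y \notin s -> phi y = 0, en phi <= C,
    en (fun y => G z y - phi y) <= e & (G z x - phi x) ^+ 2 <= C * e].
Proof.
have [C1 [C10 H1]] := eval_bound o g_connected x.
have /dirichlet0P[DG AG] := green_dirichlet0 z.
have GE0 := renergy_ge0 g (G z).
(* [C1] serves the value at x; the rest bounds Q(phi) by 2 Q(G_z) + 2 e with e <= 1. *)
exists (C1 + 2 * en (G z) + 2); split=> [|e e0 e1]; first by lra.
have [s [phi [us hs lt]]] := AG _ e0.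
have Dp := finsupp_dirichlet g us hs.
have Dd := dirichletB DG Dp.
have O0 := sqr_ge0 (G z o - phi o).
have E0 := renergy_ge0 g (fun x => G z x - phi x).
exists s, phi; split => //.
- rewrite (_ : phi = fun x => G z x + (-1) * (G z x - phi x)); last first.
    by apply/funext => t; ring.
  apply: le_trans (renergyD DG (dirichletZ (-1) Dd)) _.
  rewrite renergyZ//; lra.
- lra.
- apply: le_trans (H1 _ Dd) _; apply: ler_pM => //; lra.
Qed.

(** Formally both sides equal Q(G_x, G_y). With finitely supported psi near G_x and phi near G_y,
    the chain G_x(y), psi(y), Q(psi, phi), phi(x), G_y(x) has four small gaps, whence the factor 4
    in [C]. *)
Lemma green_sym x y : G x y = G y x.
Proof.
have [C1 [C10 H1]] := green_approx x y.
have [C2 [C20 H2]] := green_approx y x.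
apply/eqP; rewrite -subr_eq0 -sqrf_eq0 eq_le sqr_ge0 andbT.
pose C := 4 * (2 * C1 + 2 * C2).
have C0 : 0 <= C by rewrite /C; lra.
have small e : 0 < e -> e <= 1 -> (G x y - G y x) ^+ 2 <= C * e.
  move=> e0 e1.
  have [s [psi [us hs psiC dpsi vpsi]]] := H1 e e0 e1.
  have [t [phi [ut ht phiC dphi vphi]]] := H2 e e0 e1.
  pose r := undup (s ++ t); have ur : uniq r := undup_uniq _.
  have hr1 z : z \notin r -> psi z = 0.
    by rewrite mem_undup mem_cat negb_or => /andP[/hs].
  have hr2 z : z \notin r -> phi z = 0.
    by rewrite mem_undup mem_cat negb_or => /andP[_ /ht].
  (* By the reproducing property the difference is Q(G_z - chi, eta), to which Cauchy-Schwarz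
     applies. *)
  have key z (chi eta : X -> R) K : (forall q, q \notin r -> chi q = 0) ->
      (forall q, q \notin r -> eta q = 0) -> 0 <= K -> en eta <= K ->
      en (fun q => G z q - chi q) <= e ->
      (eta z - \sum_(q <- r) L chi q * eta q) ^+ 2 <= e * K.
    move=> hc he K0 etaK ce.
    have Dg : D (G z) by have /dirichlet0P[] := green_dirichlet0 z.
    have Fc := finsupp_formal_domain g ur hc.
    have Fd := formal_domainB (green_formal_domain z) Fc.
    have Dd := dirichletB Dg (finsupp_dirichlet g ur hc).
    have := laplacian_cauchy_schwarz Fd Dd ur he.
    under eq_bigr do rewrite (laplacianB _ (green_formal_domain z) Fc) mulrBl.
    rewrite sumrB green_reproducing// => H; apply: le_trans H _.
    by apply: ler_pM => //; exact: renergy_ge0.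
  have K1 := key x psi phi C2 hr1 hr2 C20 phiC dpsi.
  have K2 := key y phi psi C1 hr2 hr1 C10 psiC dphi.
  rewrite (finsupp_laplacian_sym g ur hr1 hr2) in K1.
  set S := (\sum_(q <- r) _) in K1 K2.
  have sqr4 (p1 p2 p3 p4 : R) : (p1 + p2 + p3 + p4) ^+ 2 <=
      4 * (p1 ^+ 2 + p2 ^+ 2 + p3 ^+ 2 + p4 ^+ 2).
    have := sqr_ge0 (p1 - p2); have := sqr_ge0 (p1 - p3); have := sqr_ge0 (p1 - p4).
    have := sqr_ge0 (p2 - p3); have := sqr_ge0 (p2 - p4); have := sqr_ge0 (p3 - p4).
    rewrite !expr2; lra.
  have := sqr4 (G x y - psi y) (psi y - S) (- (phi x - S)) (- (G y x - phi x)).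
  rewrite !sqrrN (_ : _ + _ + _ + _ = G x y - G y x); last by ring.
  rewrite /C; lra.
(* The added square makes the bound trivial for e > 1. *)
apply: (@eq0_small _ (C + (G x y - G y x) ^+ 2)); first by rewrite addr_ge0 ?sqr_ge0.
move=> e e0; have [e1|e1] := leP e 1.
  apply: le_trans (small e e0 e1) _.
  by rewrite ler_wpM2r ?lerDl ?sqr_ge0// ltW.
rewrite mulrDl ler_wpDl//; first by rewrite mulr_ge0// ltW.
by rewrite ler_peMr ?sqr_ge0// ltW.
Qed.

End Green.

(** * Potentials of superharmonic functions *)

Section Potentials.
Variables (R : realType) (X : countType) (g : graph R X) (o : X).
Local Notation b := (weight g).
Local Notation c := (killing g).
Local Notation F := (formal_domain g).
Local Notation L := (laplacian g).
Local Notation D0 := (dirichlet0 g o).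
Local Notation d := (total_degree g).
Implicit Types (x y z : X) (f h u v k : X -> R) (s : seq X).

(** Minimum principle: at a zero of h the Laplacian is minus the weighted sum over neighbours, so
    superharmonicity forces h to vanish at them; connectedness spreads this. *)
Lemma superharmonic_zero h x : connected_graph g -> (forall y, 0 <= h y) ->
  superharmonic g h -> h x = 0 -> forall y, h y = 0.
Proof.
move=> g_connected h0 [Fh Lh] hx y.
have [p [pp <-]] := g_connected x y.
elim: p x hx pp => [//|z p IH x] hx /= /andP[bxz]; apply: IH.
have := Lh x; rewrite laplacianE// hx mulr0 sub0r oppr_ge0 => A0.
have /formal_domainP/(_ x) sh := Fh.
have bh0 w : 0 <= b x w * h w by rewrite mulr_ge0 ?weight_ge0.
have := @esum_term_ge R X (fun w => (b x w * h w)%:E) z.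
rewrite -rsum_ge0E// lee_fin => /(_ (fun w => bh0 w)) /le_trans /(_ A0).
rewrite pmulr_rle0// => hz; apply/eqP; rewrite eq_le hz h0//.
Qed.

Hypothesis g_connected : connected_graph g.
Hypothesis g_transient : transient g o.

Local Notation G := (green_at g o).
Let G0 := green_ge0 g_connected g_transient.
Let FG := green_formal_domain g_transient.
Let LG := green_laplacian g_transient.

Definition green_potential k x : R := rsum (fun y => G y x * k y).
Local Notation pot := green_potential.

Definition green_summable k := forall x, rsummable (fun y => G y x * k y).

(** Gk need not lie in D_0, but its finite partial sums do, and their Laplacians are k on the chosen
    vertices and 0 elsewhere. Domination bounds each partial sum by v, hence also their supremum. *)
Lemma green_potential_le v k : superharmonic g v -> (forall x, 0 <= v x) ->
  (forall x, 0 <= k x) -> (forall x, k x <= L v x) ->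
  green_summable k /\ forall x, pot k x <= v x.
Proof.
move=> [Fv Lv] v0 k0 kv.
have H x : (nsum (fun y => G y x * k y) <= (v x)%:E)%E.
  apply: esum_seq_le => s us; rewrite sumEFin lee_fin.
  have -> : \sum_(y <- s) G y x * k y = \sum_(y <- s) k y * G y x.
    by apply: eq_bigr => y _; rewrite mulrC.
  have FLs t : F (fun x => \sum_(y <- t) k y * G y x) /\
      forall z, L (fun x => \sum_(y <- t) k y * G y x) z =
        \sum_(y <- t) k y * (z == y)%:R.
    elim: t => [|y t [IF IL]].
      rewrite (_ : (fun x => _) = (fun=> 0)).
        2: by apply/funext => z; rewrite big_nil.
      split=> [|z]; first exact: formal_domain_cst.
      by rewrite laplacian_cst mulr0 big_nil.
    rewrite (_ : (fun x => _) =
      (fun x => k y * G y x + \sum_(y <- t) k y * G y x)); last first.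
      by apply/funext => z; rewrite big_cons.
    have FkG := formal_domainZ (k y) (FG y).
    split=> [|z]; first exact: formal_domainD.
    by rewrite laplacianD// laplacianZ// LG IL big_cons.
  have [Fs Ls] := FLs s.
  apply: (@domination _ _ _ _ g_connected g_transient
    (fun x => \sum_(y <- s) k y * G y x) v) => //.
    exact/dirichlet0_sum/green_dirichlet0.
  move=> z; rewrite Ls; have [zs|zs] := boolP (z \in s).
    rewrite (bigD1_seq z)//= eqxx mulr1 big1 ?addr0// => y.
    by rewrite eq_sym => /negbTE ->; rewrite mulr0.
  rewrite big_seq big1// => y ys; case: eqP => [zy|]; last by rewrite mulr0.
  by rewrite zy ys in zs.
have pos x y : 0 <= G y x * k y by rewrite mulr_ge0.
have S : green_summable k.
  by move=> x; rewrite rsummable_ge0//; apply: le_lt_trans (H x) _; rewrite ltry.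
by split=> // x; rewrite -lee_fin /pot rsum_ge0E.
Qed.

Lemma green_potential_ge0 k x : (forall x, 0 <= k x) -> 0 <= pot k x.
Proof. by move=> k0; apply: rsum_ge0 => y; rewrite mulr_ge0. Qed.

(** Since the neighbour sum of G_y is d G_y - 1_y, Tonelli computes the neighbour sum of Gk as d Gk
    - k; its finiteness is the membership in the formal domain. *)
Lemma laplacian_green_ge0 k : (forall x, 0 <= k x) -> green_summable k ->
  F (pot k) /\ forall x, L (pot k) x = k x.
Proof.
move=> k0 sk.
have pos x y : 0 <= G y x * k y by rewrite mulr_ge0.
have AG x y : neighbor_sum g (G y) x = d x * G y x - (x == y)%:R.
  by have := LG y x; rewrite laplacianE//; lra.
have swap x : nsum (fun z => b x z * pot k z) =
    nsum (fun y => d x * (G y x * k y) - k y * (y == x)%:R).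
  have -> : nsum (fun z => b x z * pot k z) =
      (\esum_(z in setT) \esum_(y in setT) (b x z * (G y z * k y))%:E)%E.
    apply: eq_esum => z _; rewrite EFinM /pot rsum_ge0E// -nsumZ ?weight_ge0//.
  rewrite esum_swap => [|z y]; last by rewrite lee_fin mulr_ge0 ?weight_ge0.
  apply: eq_esum => y _.
  have /formal_domainP/(_ x) sG := FG y.
  have bG z : 0 <= b x z * G y z by rewrite mulr_ge0 ?weight_ge0.
  transitivity (nsum (fun z => k y * (b x z * G y z))).
    by apply: eq_esum => z _; congr (_%:E); ring.
  rewrite nsumZ// -rsum_ge0E// -EFinM; congr (_%:E).
  rewrite -/(neighbor_sum g (G y) x) AG eq_sym; ring.
have sd x : rsummable (fun y => d x * (G y x * k y) - k y * (y == x)%:R).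
  by apply: rsummableD; [exact: rsummableZ|exact/rsummableN/rsummable_delta].
have d0 x y : 0 <= d x * (G y x * k y) - k y * (y == x)%:R.
  (* The difference is k(y) times the neighbour sum of G_y at x. *)
  have := neighbor_sum_ge0 g x (G0 y); rewrite AG eq_sym => H.
  by have := mulr_ge0 (k0 y) H; congr (0 <= _); ring.
have bp x z : 0 <= b x z * pot k z.
  by rewrite mulr_ge0 ?weight_ge0 ?green_potential_ge0.
have Fp : F (pot k).
  apply/formal_domainP => x; rewrite rsummable_ge0// swap -rsum_ge0E//.
  exact: ltry.
have /formal_domainP sp := Fp.
split=> // x; rewrite laplacianE//.
suff -> : neighbor_sum g (pot k) x = d x * pot k x - k x by ring.
apply: EFin_inj; rewrite /neighbor_sum rsum_ge0E// swap -rsum_ge0E//.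
rewrite rsumB ?rsumZ ?rsum_delta//; [exact: rsummableZ|exact: rsummable_delta].
Qed.

Lemma laplacian_green k : green_summable k ->
  F (pot k) /\ forall x, L (pot k) x = k x.
Proof.
move=> sk.
have ep x : (fun y => G y x * k^\+ y) =1 (fun y => G y x * k y)^\+.
  by move=> y; rewrite /funrpos maxr_pMr ?mulr0.
have en x : (fun y => G y x * k^\- y) =1 (fun y => G y x * k y)^\-.
  by move=> y; rewrite /funrneg maxr_pMr ?mulr0 ?mulrN.
have sp : green_summable (k^\+)
  by move=> x; exact: eq_rsummable (ep x) (rsummable_pos (sk x)).
have sn : green_summable (k^\-)
  by move=> x; exact: eq_rsummable (en x) (rsummable_neg (sk x)).
have [Fp Lp] := laplacian_green_ge0 (funrpos_ge0 k) sp.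
have [Fn Ln] := laplacian_green_ge0 (funrneg_ge0 k) sn.
have -> : pot k = fun x => pot k^\+ x - pot k^\- x.
  by apply/funext => x; rewrite /pot (rsumE (sk x)) (eq_rsum (ep x)) (eq_rsum (en x)).
split=> [|x]; first exact: formal_domainB.
by rewrite laplacianB// Lp Ln -[in RHS](funrposBneg k).
Qed.

(** Applying [L] to u = Gk recovers k, so the only possible density is [L u]. *)
Lemma superharmonic_potentialP u : superharmonic g u ->
  potential g o u <-> green_summable (L u) /\ u = pot (L u).
Proof.
move=> [Fu Lu]; split=> [[_ [k Gk uE]]|[sL uE]].
  have sk : green_summable k.
    move=> x; have := Gk x; rewrite /summable; apply: le_lt_trans.
    apply: le_esum => y _; rewrite /= lee_fin normrM ger0_norm// /green.
    exact: ler_norm.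
  have uk : u = pot k.
    apply/funext => x; apply: EFin_inj; rewrite uE /pot /rsum fineK//.
    by rewrite -[tsum _]/(green_op g o k x) -uE.
  have [_ Lk] := laplacian_green sk.
  by have -> : L u = k by rewrite uk; exact/funext.
split=> //; exists (L u) => x.
  apply: eq_rsummable (sL x) => y.
  by rewrite (ger0_norm (Lu y)).
rewrite {1}uE /pot /green_op /rsum fineK// tsum_ge0 => [|y]; last by rewrite mulr_ge0.
by rewrite -rsum_ge0E// => y; rewrite mulr_ge0.
Qed.

Lemma superharmonic_potential_ge0 u x : superharmonic g u -> potential g o u ->
  0 <= u x.
Proof.
move=> Su; have [_ Lu] := Su => /(superharmonic_potentialP Su)[_ ->].
exact: green_potential_ge0.
Qed.

(** One inequality is [green_potential_le]; the other is domination of u by G(Lu), which has the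
    same Laplacian. *)
Lemma dirichlet0_potential u : superharmonic g u -> D0 u -> potential g o u.
Proof.
move=> Su Du; apply/(superharmonic_potentialP Su).
have u0 := superharmonic_dirichlet0_ge0 g_connected g_transient Du Su.
have [Fu Lu] := Su.
have [sL le] := green_potential_le Su u0 Lu (fun x => lexx _).
split=> //; apply/funext => x; apply/eqP; rewrite eq_le le andbT.
have [Fp Lp] := laplacian_green sL.
apply: (domination g_connected g_transient Du) => //.
  by move=> y; exact: green_potential_ge0.
by move=> y; rewrite Lp.
Qed.

Lemma superharmonic_cst1 : superharmonic g (fun=> 1).
Proof.
split=> [|x]; first exact: formal_domain_cst.
by rewrite laplacian_cst mulr1 killing_ge0.
Qed.

Lemma green_killing_le1 : green_summable c /\ forall x, pot c x <= 1.
Proof.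
apply: (green_potential_le superharmonic_cst1) => // x; first exact: killing_ge0.
by rewrite laplacian_cst mulr1.
Qed.

Lemma green_killing_eq1 x : pot c x = 1 -> forall y, pot c y = 1.
Proof.
have [sc le1] := green_killing_le1 => px y.
have [Fc Lc] := laplacian_green sc.
have F1 := formal_domain_cst g 1.
suff : 1 - pot c y = 0 by lra.
apply: (@superharmonic_zero (fun y => 1 - pot c y) x) => //.
- by move=> z; rewrite subr_ge0.
- split=> [|z]; first exact: formal_domainB.
  by rewrite laplacianB// laplacian_cst Lc mulr1 subrr.
- by rewrite px subrr.
Qed.

Lemma nsum_killing_potential k : (forall x, 0 <= k x) -> green_summable k ->
  nsum (fun x => c x * pot k x) = nsum (fun x => k x * pot c x).
Proof.
move=> k0 sk; have [sc _] := green_killing_le1; have c0 := killing_ge0 g.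
have E k1 k2 : (forall x, 0 <= k1 x) -> (forall x, 0 <= k2 x) -> green_summable k2 ->
    nsum (fun x => k1 x * pot k2 x) =
    (\esum_(x in setT) \esum_(y in setT) (k1 x * (G y x * k2 y))%:E)%E.
  move=> k10 k20 s2; apply: eq_esum => x _.
  rewrite EFinM /pot rsum_ge0E// => [|y]; last by rewrite mulr_ge0.
  by rewrite -nsumZ// => y; rewrite mulr_ge0.
rewrite !E// esum_swap => [|x y]; last by rewrite lee_fin !mulr_ge0.
apply: eq_esum => x _; apply: eq_esum => y _; congr (_%:E).
rewrite (green_sym g_connected g_transient x y); ring.
Qed.

End Potentials.

Theorem theorem13 (R : realType) (X : countType) (g : graph R X) (o : X)
    (g_connected : connected_graph g) (g_transient : transient g o) :
  (* the terms of both sums in (iv.a) are nonnegative *)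
  (forall u : X -> R, superharmonic g u ->
     potential g o u \/ dirichlet0 g o u ->
     forall x, 0 <= laplacian g u x /\ 0 <= killing g x * u x) /\
  [<->
   (* (ii.a) *)
   exists x, green_op g o (killing g) x = 1%E;
   forall x, green_op g o (killing g) x = 1%E;
   potential g o (fun=> 1);
   (* (iv.a) *)
   exists u : X -> R,
     [/\ superharmonic g u, potential g o u, ell1 g u, exists x, u x != 0
       & tsum (laplacian g u) = tsum (fun x => killing g x * u x)];
   forall u : X -> R, superharmonic g u -> potential g o u ->
     tsum (laplacian g u) = tsum (fun x => killing g x * u x);
   forall u : X -> R, superharmonic g u -> dirichlet0 g o u ->
     tsum (laplacian g u) = tsum (fun x => killing g x * u x);
   (* (iv.b) *)
   forall u : X -> R, (forall x, 0 <= u x) -> superharmonic g u -> ell1 g u ->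
     (potential g o u <->
      [/\ summable [set: X] (fun x => (laplacian g u x)%:E),
          summable [set: X] (fun x => (killing g x * u x)%:E)
        & tsum (laplacian g u) = tsum (fun x => killing g x * u x)]);
   (* (iv.c) *)
   exists x, 1%E = tsum (fun y => killing g y * green_at g o x y);
   forall x, 1%E = tsum (fun y => killing g y * green_at g o x y)].

Proof.
set c := killing g; set G := green_at g o; set L := laplacian g.
have c0 : forall x, 0 <= c x := killing_ge0 g.
have [sc gc_le1] := green_killing_le1 g_connected g_transient.
pose gc := green_potential g o c.
have [_ Lc] := laplacian_green g_connected g_transient sc.
have G0 := green_ge0 g_connected g_transient.
have Gc0 x y : 0 <= G y x * c y by rewrite mulr_ge0//; exact: G0.
have gc_eq1 x : gc x = 1 -> forall y, gc y = 1.
  exact: green_killing_eq1.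
have green_opE x : green_op g o c x = (gc x)%:E.
  rewrite /green_op tsum_ge0 => [|y]; last exact: Gc0.
  by rewrite -(rsum_ge0E (sc x) (Gc0 x)).
have tsum_greenE x : tsum (fun y => c y * G x y) = (gc x)%:E.
  rewrite -green_opE /green_op; congr tsum; apply/funext => y.
  by rewrite mulrC [G x y](green_sym g_connected g_transient).
have pot0 u : superharmonic g u -> potential g o u -> forall x, 0 <= u x.
  move=> Su Pu x.
  exact: (superharmonic_potential_ge0 g_connected g_transient x Su Pu).
have cu0 u : superharmonic g u -> potential g o u -> forall x, 0 <= c x * u x.
  by move=> Su Pu x; rewrite mulr_ge0//; exact: pot0.
have D0P u : superharmonic g u -> dirichlet0 g o u -> potential g o u.
  exact: dirichlet0_potential.
have tsumL u : superharmonic g u -> tsum (L u) = nsum (L u).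
  by move=> [_ Lu]; rewrite tsum_ge0.
have tsumc u : superharmonic g u -> potential g o u ->
    tsum (fun x => c x * u x) = nsum (fun x => L u x * gc x).
  move=> Su Pu; rewrite tsum_ge0; last exact: cu0.
  have [sL uE] := (superharmonic_potentialP g_connected g_transient Su).1 Pu.
  have [_ Lu] := Su.
  by rewrite {1}uE nsum_killing_potential.
have balance u : (forall x, gc x = 1) -> superharmonic g u -> potential g o u ->
    tsum (L u) = tsum (fun x => c x * u x).
  move=> g1 Su Pu; rewrite tsumc// tsumL//.
  by apply: eq_esum => x _; rewrite g1 mulr1.
have SGo : superharmonic g (G o).
  split=> [|x]; first exact: green_formal_domain.
  by rewrite green_laplacian// ler0n.
have PGo : potential g o (G o) by apply: D0P => //; exact: green_dirichlet0.
have LGo : tsum (L (G o)) = 1%E.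
  rewrite tsumL// -(nsum_delta R o); apply: eq_esum => x _.
  by rewrite /L green_laplacian.
(* By symmetry of G, this is the finiteness of Gc(o). *)
have GoE : ell1 g (G o).
  have : (tsum (fun y => c y * G o y)%R < +oo)%E by rewrite tsum_greenE ltry.
  rewrite tsum_ge0; last exact: cu0.
  apply: le_lt_trans; apply: le_esum => x _.
  by rewrite (ger0_norm (pot0 _ SGo PGo x)).
split=> [u Su [Pu|Du] x|].
- by split; [case: Su|exact: cu0].
- by split; [case: Su|apply: cu0 => //; exact: D0P].
tfae.
- by case=> x; rewrite green_opE => -[/gc_eq1 g1] y; rewrite green_opE g1.
- move=> H; split; first exact: formal_domain_cst.
  exists c => // x; apply: eq_rsummable (sc x) => y.
  by rewrite (ger0_norm (c0 y)).
- move=> P1; have S1 := superharmonic_cst1 g.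
  have [_ E1] := (superharmonic_potentialP g_connected g_transient S1).1 P1.
  have g1 x : gc x = 1.
    rewrite -[RHS](congr1 (@^~ x) (esym E1)) /gc; congr (green_potential _ _ _ x).
    by apply/funext => y; rewrite laplacian_cst mulr1.
  exists (G o); split=> //; last exact: balance.
  (* If G_o vanished identically, so would its Laplacian, which is 1 at o. *)
  apply: contrapT => /forallNP H.
  have := green_laplacian g_transient o o.
  rewrite eqxx laplacianE; last exact: green_formal_domain.
  have Z x : G o x = 0 by apply/eqP/negPn/negP => /H.
  rewrite -/G Z mulr0 /neighbor_sum.
  rewrite (@eq_rsum _ _ _ (fun=> 0)) => [|x]; last by rewrite Z mulr0.
  by rewrite /rsum tsum_ge0// esum1// subrr => /esym/eqP; rewrite oner_eq0.
- move=> [u [Su Pu u1 [x ux] E]].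
  have [sL uE] := (superharmonic_potentialP g_connected g_transient Su).1 Pu.
  have [_ Lu] := Su.
  have Lg0 y : 0 <= L u y * gc y.
    by rewrite mulr_ge0 ?Lu// /gc green_potential_ge0.
  (* Membership in l^1(X, c) makes this sum finite; the balance identity passes finiteness on to the
     sum of Lu, so the two sums may be subtracted. *)
  have sLg : rsummable (fun y => L u y * gc y).
    rewrite rsummable_ge0// -tsumc// tsum_ge0; last exact: cu0.
    apply: le_lt_trans u1; apply: le_esum => y _.
    by rewrite (ger0_norm (pot0 _ Su Pu y)).
  have sLu : rsummable (L u).
    rewrite rsummable_ge0; last exact: Lu.
    by rewrite -tsumL// E tsumc// -rsummable_ge0.
  have [g1|/existsNP[y gy]] := pselect (forall y, gc y = 1).
    by move=> v Sv Pv; exact: balance.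
  (* The terms are nonnegative as Gc <= 1, and they add up to the difference of the two sides of the
     identity. As Gc misses 1 at y, it misses it everywhere; so Lu = 0 and u = G(Lu) = 0, against
     nontriviality. *)
  have Z : forall y, L u y * (1 - gc y) = 0.
    apply: rsum_eq0.
    - by apply: eq_rsummable (rsummableD sLu (rsummableN sLg)) => z; ring.
    - by move=> z; rewrite mulr_ge0 ?Lu// subr_ge0.
    - rewrite (@eq_rsum _ _ _ (fun z => L u z - L u z * gc z)); last by move=> z; ring.
      by rewrite rsumB// /rsum E tsumc// tsum_ge0// subrr.
  have Lz z : L u z = 0.
    apply/eqP; have /eqP := Z z; rewrite mulf_eq0 => /orP[//|].
    by rewrite subr_eq0 => /eqP /esym /gc_eq1 /(_ y) /gy.
  move: ux; rewrite uE /green_potential (@eq_rsum _ _ _ (fun=> 0)) => [|z].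
    by rewrite /rsum tsum_ge0// esum1// eqxx.
  by rewrite -/L Lz mulr0.
- by move=> H u Su Du; apply: H => //; exact: D0P.
- move=> H.
  have g1 x : gc x = 1.
    apply: (gc_eq1 o); apply: EFin_inj; rewrite -tsum_greenE -H//.
    exact: green_dirichlet0.
  move=> u u0 Su u1; have [Fu Lu] := Su.
  have sc' : rsummable (fun x => c x * u x).
    apply: le_lt_trans u1; apply: le_esum => x _.
    by rewrite lee_fin normrM (ger0_norm (c0 x)).
  split=> [Pu|[sL _ E]].
    split=> //; last exact: balance.
    rewrite rsummable_ge0; last exact: Lu.
    rewrite -tsumL// balance// tsum_ge0; last exact: cu0.
    by rewrite -rsummable_ge0//; exact: cu0.
  have [sG le] := green_potential_le g_connected g_transient Su u0 Lu (fun x => lexx _).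
  have [Fp Lp] := laplacian_green g_connected g_transient sG.
  set v := green_potential g o (laplacian g u) in le Fp Lp.
  have v0 x : 0 <= v x by exact: green_potential_ge0.
  have Sw : superharmonic g (fun x => u x - v x).
    split=> [|x]; first exact: formal_domainB.
    by rewrite laplacianB// Lp subrr.
  have w0 x : 0 <= u x - v x by rewrite subr_ge0.
  have scv : rsummable (fun x => c x * v x).
    apply: rsummable_le sc' => x; rewrite ger0_norm ?mulr_ge0//.
    by rewrite ler_wpM2l.
  (* Since Gc = 1, the sum of c v is the sum of Lu, which the hypothesis equates with the sum of c
     u. *)
  have Z : forall x, c x * (u x - v x) = 0.
    apply: rsum_eq0.
    - by apply: eq_rsummable (rsummableD sc' (rsummableN scv)) => z; ring.
    - by move=> z; rewrite mulr_ge0.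
    - rewrite (@eq_rsum _ _ _ (fun z => c z * u z - c z * v z)); last by move=> z; ring.
      rewrite rsumB// /rsum -E tsumL// (@tsum_ge0 _ _ (fun x => c x * v x)) => [|x].
        2: by rewrite mulr_ge0.
      rewrite nsum_killing_potential//.
      rewrite [X in _ - fine X](_ : _ = nsum (L u)) ?subrr//.
      by apply: eq_esum => x _; rewrite -/(gc x) g1 mulr1.
  apply/(superharmonic_potentialP g_connected g_transient Su); split=> //.
  apply/funext => x; apply/eqP; rewrite -subr_eq0; apply/eqP.
  (* Gc = 1 excludes c = 0. At a vertex with c nonzero the harmonic part u - v vanishes, and the
     minimum principle finishes. *)
  have [cz|/existsNP[z cz]] := pselect (forall z, c z = 0).
    have := g1 x; rewrite /gc /green_potential (@eq_rsum _ _ _ (fun=> 0)) => [|y].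
      2: by rewrite cz mulr0.
    by rewrite /rsum tsum_ge0// esum1// => /esym/eqP; rewrite oner_eq0.
  apply: (superharmonic_zero g_connected w0 Sw (x := z)).
  by have /eqP := Z z; rewrite mulf_eq0 => /orP[/eqP//|/eqP].
- move=> H; exists o; apply/esym.
  have /(H _ (pot0 _ SGo PGo) SGo GoE)[_ _ E] := PGo.
  by rewrite -E LGo.
- move=> [x]; rewrite tsum_greenE => -[/esym /gc_eq1 g1] y.
  by rewrite tsum_greenE g1.
- by move=> H; exists o; rewrite green_opE -tsum_greenE -H.
Qed.
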